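(* \textsc{PAU-VC} can be solved in linear time on unit interval graphs: there is an algorithm that, given a unit interval graph $G$, outputs a minimum set $S\subseteq V(G)$ such that there is exactly one minimum vertex cover of $G$ containing $S$, in time $O(|V(G)|+|E(G)|)$.
   Context: All graphs are finite and simple. A vertex cover of $G$ is a set of vertices meeting every edge. \textsc{PAU-VC}: given a graph $G$, find a minimum set $S\subseteq V(G)$ such that there is exactly one minimum vertex cover of $G$ containing $S$. A unit interval graph is the intersection graph of a finite family of closed intervals of length one on the real line. *)

(* Defs.v *)
From mathcomp Require Import all_boot all_order all_algebra.
From mathcomp Require Import reals.

Set Implicit Arguments.
Unset Strict Implicit.
Unset Printing Implicit Defensive.

Import Order.TTheory GRing.Theory Num.Theory.

Record sgraph (T : finType) := SGraph {
  edge :> rel T;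
  edge_sym : symmetric edge;
  edge_irr : irreflexive edge }.

Section Graphs.
Variables (T : finType) (G : sgraph T).

Definition edges : {set {set T}} :=
  [set [set p.1; p.2] | p : T * T & G p.1 p.2].

Definition vertex_cover (C : {set T}) : bool :=
  [forall x, forall y, G x y ==> (x \in C) || (y \in C)].

Definition min_vertex_cover (C : {set T}) : bool :=
  vertex_cover C && [forall D : {set T}, vertex_cover D ==> (#|C| <= #|D|)].

Definition pau_set (S : {set T}) : bool :=
  #|[set C | min_vertex_cover C & S \subset C]| == 1.

Definition min_pau_set (S : {set T}) : bool :=
  pau_set S && [forall S' : {set T}, pau_set S' ==> (#|S| <= #|S'|)].

(* The family of intervals is indexed by the vertices, so distinct vertices
   may carry the same interval. *)
Definition unit_interval_graph (R : realType) : Prop :=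
  exists l : T -> R, forall x y : T,
    G x y <-> x != y /\
      exists t : R, (t \in `[l x, l x + 1] /\ t \in `[l y, l y + 1])%R.

End Graphs.

(* Machine model: a random access machine presented as a structured imperative
   language.  A program uses finitely many scalar variables and zero-initialised
   arrays, named by natural numbers and holding natural numbers.  Every
   elementary operation (constant, variable read, array read at a computed
   index, addition, truncated subtraction, comparison, assignment, array write,
   branch) costs one time unit. *)

Inductive binop := OAdd | OSub | OLt | OEq.

Inductive expr :=
  | Const of nat
  | Var of nat
  | Get of nat & expr
  | Bin of binop & expr & expr.

Inductive cmd :=
  | Skip
  | Assign of nat & expr
  | Put of nat & expr & expr
  | Seq of cmd & cmd
  | If of expr & cmd & cmd
  | While of expr & cmd.

Record state := State {
  var : nat -> nat;
  arr : nat -> nat -> nat }.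

Definition set_var (s : state) (x v : nat) : state :=
  State (fun y => if y == x then v else var s y) (arr s).

Definition set_arr (s : state) (a i v : nat) : state :=
  State (var s)
    (fun b j => if (b == a) && (j == i) then v else arr s b j).

Definition binop_val (o : binop) (u v : nat) : nat :=
  match o with
  | OAdd => u + v
  | OSub => u - v
  | OLt => u < v
  | OEq => u == v
  end.

(* W is the largest integer that fits in a machine word: an expression has no
   value, and the computation is stuck, as soon as some intermediate result
   exceeds W.  This prevents long integers from being used as cheap storage. *)
Definition word (W v : nat) : option nat := if v <= W then Some v else None.

Fixpoint eval (W : nat) (s : state) (e : expr) : option nat :=
  match e with
  | Const k => word W k
  | Var x => word W (var s x)
  | Get a e1 =>
      if eval W s e1 is Some i then word W (arr s a i) else None
  | Bin o e1 e2 =>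
      if eval W s e1 is Some u then
        if eval W s e2 is Some v then word W (binop_val o u v) else None
      else None
  end.

Fixpoint cost (e : expr) : nat :=
  match e with
  | Const _ | Var _ => 1
  | Get _ e1 => (cost e1).+1
  | Bin _ e1 e2 => (cost e1 + cost e2).+1
  end.

(* exec W c s t s': with word bound W, running c from s halts in s' after
   exactly t time units.  A test succeeds when its value is nonzero. *)
Inductive exec (W : nat) : cmd -> state -> nat -> state -> Prop :=
  | ExecSkip s : exec W Skip s 1 s
  | ExecAssign s x e v :
      eval W s e = Some v ->
      exec W (Assign x e) s (cost e).+1 (set_var s x v)
  | ExecPut s a ei ev i v :
      eval W s ei = Some i -> eval W s ev = Some v ->
      exec W (Put a ei ev) s (cost ei + cost ev).+1 (set_arr s a i v)
  | ExecSeq s s1 s2 c1 c2 t1 t2 :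
      exec W c1 s t1 s1 -> exec W c2 s1 t2 s2 ->
      exec W (Seq c1 c2) s (t1 + t2) s2
  | ExecIf s s1 e v c1 c2 t :
      eval W s e = Some v -> exec W (if v != 0 then c1 else c2) s t s1 ->
      exec W (If e c1 c2) s ((cost e).+1 + t) s1
  | ExecWhileEnd s e c :
      eval W s e = Some 0 -> exec W (While e c) s (cost e).+1 s
  | ExecWhileStep s s1 s2 e v c t1 t2 :
      eval W s e = Some v -> v != 0 ->
      exec W c s t1 s1 -> exec W (While e c) s1 t2 s2 ->
      exec W (While e c) s ((cost e).+1 + t1 + t2) s2.

Section InputOutput.
Variable n : nat.

(* The neighbours of each vertex are listed once, in an arbitrary order. *)
Definition adjacency_lists (G : sgraph 'I_n) (adj : 'I_n -> seq 'I_n) : Prop :=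
  forall v, uniq (adj v) /\ adj v =i G v.

(* Input: variable 0 contains n; array 1 contains the adjacency lists of the
   vertices 0, ..., n - 1, one after the other; the list of vertex v occupies
   the cells i of array 1 with off v <= i < off v.+1, where off is stored in the
   cells 0, ..., n of array 0.  All the rest is 0. *)
Definition init_state (adj : 'I_n -> seq 'I_n) : state :=
  let lists := [seq [seq val u | u <- adj v] | v <- enum 'I_n] in
  let offsets := [seq sumn (take i (shape lists)) | i <- iota 0 n.+1] in
  State (fun x => if x == 0 then n else 0)
        (fun a i => if a == 0 then nth 0 offsets i
                    else if a == 1 then nth 0 (flatten lists) i
                    else 0).

(* Output: the elements of S, without repetition and in an arbitrary order, in
   the first cells of array 2, and their number in variable 1. *)
Definition outputs (s : state) (S : {set 'I_n}) : Prop :=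
  perm_eq (mkseq (arr s 2) (var s 1)) [seq val v | v <- enum S].

End InputOutput.

(* Main.v *)
(* In a unit interval graph every vertex outside a maximum independent set I has
   one or two neighbours in I.  A set S leaves exactly one minimum vertex cover
   V - I containing S only if it contains the set of the vertices with exactly
   one neighbour in I, because these can be exchanged with that neighbour; and
   this set is sufficient.  By double counting its size is
   2 (n - #|I|) - \sum_(x in I) deg x, so I has to be a maximum independent set
   of maximum degree sum, that is an independent set of maximum weight for the
   weights K + deg x with K larger than the sum of all degrees.  Such a set is
   found by Frank's algorithm along the reverse of a maximum cardinality search
   order, which is a perfect elimination order.  The search keeps the unvisited
   vertices in stacks according to their number of visited neighbours; obsolete
   entries are skipped when they are popped. *)
Require Import Defs.
From mathcomp Require Import all_boot all_order all_algebra.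
From mathcomp Require Import reals lra zify.

Set Implicit Arguments.
Unset Strict Implicit.
Unset Printing Implicit Defensive.

(** * Independent sets of unit interval graphs *)

Section Graph.
Variables (T : finType) (G : sgraph T).

Definition nbrs (x : T) : {set T} := [set y | G x y].
Definition indep (I : {set T}) : Prop := {in I &, forall x y, ~~ G x y}.
Definition max_indep (I : {set T}) : Prop :=
  indep I /\ forall J : {set T}, indep J -> #|J| <= #|I|.
Definition singly (I : {set T}) : {set T} := [set y | #|nbrs y :&: I| == 1].

Lemma edgeC x y : G x y = G y x. Proof. exact: edge_sym. Qed.

Lemma vertex_coverP (C : {set T}) :
  reflect (indep (~: C)) (vertex_cover G C).
Proof.
apply: (iffP forallP) => [H x y|H x].
  rewrite !inE => xC yC; apply/negP => Gxy.
  by have /forallP/(_ y)/implyP/(_ Gxy) := H x; rewrite (negbTE xC) (negbTE yC).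
apply/forallP => y; apply/implyP; apply: contraLR.
by rewrite negb_or => /andP[xC yC]; apply: H; rewrite inE.
Qed.

Lemma min_vertex_coverP (C : {set T}) :
  reflect (max_indep (~: C)) (min_vertex_cover G C).
Proof.
apply: (iffP andP) => [[/vertex_coverP iC /forallP mC]|[iC mC]]; split => //.
- move=> J iJ; have /implyP := mC (~: J).
  have -> : vertex_cover G (~: J) by apply/vertex_coverP; rewrite setCK.
  move=> /(_ isT); have := cardsC J; have := cardsC C; lia.
- exact/vertex_coverP.
- apply/forallP => D; apply/implyP => /vertex_coverP/mC.
  have := cardsC D; have := cardsC C; lia.
Qed.

Lemma indep_nbrs I y : indep I -> y \in I -> #|nbrs y :&: I| = 0.
Proof.
move=> iI yI; apply/eqP; rewrite cards_eq0; apply/eqP/setP => x; rewrite !inE.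
by case: (boolP (x \in I)) => xI; rewrite ?andbF // (negbTE (iI _ _ yI xI)).
Qed.

Lemma max_indep_nbrs I y : max_indep I -> y \notin I -> 0 < #|nbrs y :&: I|.
Proof.
move=> [iI mI] yI; rewrite lt0n cards_eq0; apply: contraNneq yI => N0.
suff /mI : indep (y |: I) by rewrite cardsU1; case: (y \in I) => //; lia.
have Ny x : x \in I -> ~~ G y x.
  by move=> xI; have /setP/(_ x) := N0; rewrite !inE xI andbT => ->.
move=> a b; rewrite !inE => /predU1P[->|aI] /predU1P[->|bI].
- by rewrite edge_irr.
- exact: Ny.
- by rewrite edgeC Ny.
- exact: iI.
Qed.

Lemma sum_nbrsC (A B : {set T}) :
  \sum_(y in A) #|nbrs y :&: B| = \sum_(x in B) #|nbrs x :&: A|.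
Proof.
have E (C D : {set T}) : \sum_(y in C) #|nbrs y :&: D| =
    \sum_y \sum_x [&& y \in C, x \in D & G y x].
  rewrite big_mkcond; apply: eq_bigr => y _; case: (y \in C); last by rewrite big1.
  rewrite -sum1_card big_mkcond; apply: eq_bigr => x _.
  by rewrite !inE andbC; case: (_ && _).
rewrite !E exchange_big; apply: eq_bigr => x _; apply: eq_bigr => y _.
by rewrite edgeC andbCA.
Qed.

(** Replacing in [J] the only neighbour [x] of [y] by [y] preserves independence and size. *)
Lemma singly_swap J y : max_indep J -> y \in singly J ->
  exists2 K, max_indep K & y \in K /\ K \subset y |: J.
Proof.
move=> [iJ mJ] yS; have yJ : y \notin J.
  by apply/negP => yJ; move: yS; rewrite inE indep_nbrs.
move: yS; rewrite inE => /cards1P[x Nx].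
have xN : x \in nbrs y :&: J by rewrite Nx inE.
move: xN; rewrite !inE => /andP[Gyx xJ].
exists (y |: J :\ x); last by rewrite !inE eqxx; split=> //; apply/setUS/subsetDl.
have cK : #|y |: J :\ x| = #|J|.
  by rewrite cardsU1 !inE (negbTE yJ) andbF (cardsD1 x J) xJ.
have Ny z : z \in J -> z != x -> ~~ G y z.
  move=> zJ; apply: contraNN => Gyz.
  by rewrite -in_set1 -Nx !inE Gyz.
split=> [a b|K iK]; last by rewrite cK mJ.
rewrite !inE => /predU1P[->|/andP[ax aJ]] /predU1P[->|/andP[bx bJ]].
- by rewrite edge_irr.
- exact: Ny.
- by rewrite edgeC Ny.
- exact: iJ.
Qed.

(** Complementation turns minimum vertex covers containing [S] into maximum independent sets
    avoiding [S]. *)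
Lemma pau_setP (S : {set T}) :
  reflect (exists2 J, max_indep J /\ [disjoint S & J] &
             forall K, max_indep K -> [disjoint S & K] -> K = J)
          (pau_set G S).
Proof.
have E (C : {set T}) :
    (C \in [set C | min_vertex_cover G C & S \subset C]) =
    min_vertex_cover G C && [disjoint S & ~: C].
  by rewrite inE disjoints_subset setCK.
apply: (iffP cards1P) => [[C H]|[J [mJ dJ] uJ]].
  have : C \in [set C] by rewrite inE.
  rewrite -H E => /andP[/min_vertex_coverP mC dC].
  exists (~: C) => // K mK dK; suff <- : ~: K = C by rewrite setCK.
  apply/set1P; rewrite -H E setCK dK andbT.
  by apply/min_vertex_coverP; rewrite setCK.
exists (~: J); apply/setP => C; rewrite E inE; apply/andP/eqP => [[mC dC]|->].
  by rewrite -(uJ (~: C)) ?setCK //; apply/min_vertex_coverP.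
by rewrite setCK dJ; split=> //; apply/min_vertex_coverP; rewrite setCK.
Qed.

(** If some [y] in [singly J] were outside [S], the exchange at [y] would give a second maximum
    independent set avoiding [S]. *)
Lemma pau_set_singly S : pau_set G S ->
  exists2 J, max_indep J & singly J \subset S.
Proof.
move=> /pau_setP[J [mJ dJ] uJ]; exists J => //; apply/subsetP => y yS.
have [K mK [yK sK]] := singly_swap mJ yS.
apply: contraT => ySn; have KJ : K = J.
  apply: uJ => //; apply/pred0P => z /=; apply/negbTE/negP => /andP[zS zK].
  have := subsetP sK z zK; rewrite !inE => /predU1P[zy|zJ].
    by rewrite -zy zS in ySn.
  by have /pred0P/(_ z) := dJ; rewrite /= zS zJ.
move: yS; rewrite inE indep_nbrs //; first by case: mJ.
by rewrite -KJ.
Qed.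

(** Ordered adjacent pairs are grouped by their underlying edge, and an edge comes only from its two
    orientations. *)
Lemma sum_deg_edges : \sum_x #|nbrs x| <= 2 * #|edges G|.
Proof.
pose P := [set p : T * T | G p.1 p.2].
have -> : \sum_x #|nbrs x| = #|P|.
  under eq_bigr do rewrite -sum1_card.
  rewrite pair_big_dep /= -sum1_card; apply: eq_bigl => p /=.
  by rewrite !inE.
have -> : #|P| = \sum_(e in edges G) #|[set p in P | [set p.1; p.2] == e]|.
  under eq_bigr do rewrite -sum1_card.
  rewrite -sum1_card (partition_big (fun p : T * T => [set p.1; p.2])
     (mem (edges G))) /=.
    by apply: eq_bigr => e _; apply: eq_bigl => p; rewrite !inE.
  by move=> p; rewrite inE => Gp; apply/imsetP; exists p; rewrite ?inE.
rewrite mulnC -sum_nat_const; apply: leq_sum => e /imsetP[q _ ->].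
apply: (@leq_trans #|[set q; (q.2, q.1)]|); last first.
  by rewrite cards2; case: (_ == _).
apply/subset_leq_card/subsetP => p; rewrite !inE => /andP[Gp /eqP E].
have Np : p.1 != p.2 by apply: contraTneq Gp => ->; rewrite edge_irr.
have : p.1 \in [set q.1; q.2] by rewrite -E !inE eqxx.
have : p.2 \in [set q.1; q.2] by rewrite -E !inE eqxx orbT.
rewrite !inE; case: p q Np {Gp E} => p1 p2 [q1 q2] /=.
move=> N /orP[]/eqP E2 /orP[]/eqP E1; rewrite E1 E2 eqxx ?orbT // in N *.
Qed.

(** * Perfect elimination orders and Frank's algorithm *)

Fixpoint simplicial_order (l : seq T) : Prop :=
  if l is v :: l' then
    [/\ v \notin l',
        {in l' &, forall x y, G v x -> G v y -> x != y -> G x y}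
      & simplicial_order l']
  else True.

Lemma simplicial_order_uniq l : simplicial_order l -> uniq l.
Proof. by elim: l => //= a l IH [-> _ /IH ->]. Qed.

Definition reduce (w : T -> nat) (v u : T) := if G v u then w u - w v else w u.

(* Discarding a simplicial vertex v and subtracting w v from its neighbours
   lowers the weight of every independent set by at most w v. *)
Fixpoint frank (w : T -> nat) (l : seq T) : seq T :=
  if l is v :: l' then
    let I := frank (reduce w v) l' in
    if (0 < w v) && ~~ has (G v) I then v :: I else I
  else [::].

Lemma frank_sub w l : {subset frank w l <= l}.
Proof.
elim: l w => //= v l IH w x; case: ifP => _; rewrite !inE.
  by case/predU1P => [->|/IH ->]; rewrite ?eqxx ?orbT.
by move=> /IH ->; rewrite orbT.
Qed.

(** Positivity ensures that the truncated subtraction in [reduce] loses nothing on selected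
    vertices. *)
Lemma frank_gt0 w l : {in frank w l, forall x, 0 < w x}.
Proof.
elim: l w => //= v l IH w x.
have IH' : x \in frank (reduce w v) l -> 0 < w x.
  by move=> /IH; rewrite /reduce; case: ifP => // _; lia.
by case: ifP => // /andP[wv _]; rewrite inE => /predU1P[->|/IH'].
Qed.

Lemma frank_indep w l : indep [set x in frank w l].
Proof.
elim: l w => [|v l IH] w /=; first by move=> x y; rewrite inE.
case: ifP => // /andP[_ /hasPn hN] x y; rewrite !inE.
move=> /predU1P[->|xI] /predU1P[->|yI].
- by rewrite edge_irr.
- exact: hN.
- by rewrite edgeC hN.
- by apply: (IH (reduce w v)); rewrite inE.
Qed.

Lemma frank_uniq w l : uniq l -> uniq (frank w l).
Proof.
elim: l w => //= v l IH w /andP[vl ul]; case: ifP => _; rewrite /= ?IH //.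
by rewrite andbT; apply: contra vl => /frank_sub.
Qed.

(** Going back from [reduce w v] to [w] raises the weight of [J] by at most [w v], since [J] meets
    the clique of [v] and its later neighbours at most once. The selected set gains at least [w v],
    through a selected neighbour of [v] or through [v] itself. *)
Lemma frank_opt w l (J : {set T}) : simplicial_order l -> indep J ->
  \sum_(x <- l | x \in J) w x <= \sum_(x <- frank w l) w x.
Proof.
move=> sl iJ; elim: l w sl => [|v l IH] w /=; first by rewrite !big_nil.
move=> [vl cl sl].
set w' := reduce w v; set I := frank w' l.
have ul := simplicial_order_uniq sl.
have wI : \sum_(x <- I) w' x + (has (G v) I) * w v <= \sum_(x <- I) w x.
  have pI : {in I, forall x, 0 < w' x} by exact: frank_gt0.
  elim: (I) pI => [|x I' IHI] pI; first by rewrite !big_nil.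
  have px := pI x (mem_head _ _).
  have {}IHI : \sum_(x <- I') w' x + has (G v) I' * w v <= \sum_(x <- I') w x.
    by apply: IHI => y yI; apply: pI; rewrite inE yI orbT.
  have wx : w x = w' x + G v x * w v.
    by move: px; rewrite /w' /reduce; case: (G v x) => /= px; lia.
  rewrite !big_cons /= wx.
  by case: (G v x) (has _ _) IHI => -[] /=; lia.
(* On [J] truncation may occur, but it only makes [w'] larger than the true difference, which is the
   harmless direction. *)
have wJ : \sum_(x <- l | x \in J) w x <=
    \sum_(x <- l | x \in J) w' x + count (fun x => (x \in J) && G v x) l * w v.
  elim: (l) => [|x l' IHl]; first by rewrite !big_nil.
  rewrite !big_cons /=; case: (x \in J) => /=; last by rewrite add0n.
  have : w x <= w' x + G v x * w v.
    by rewrite /w' /reduce; case: (G v x) => /=; lia.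
  by case: (G v x) => /=; lia.
have cJ : count (fun x => (x \in J) && G v x) l + (v \in J) <= 1.
  case: (boolP (v \in J)) => vJ.
    rewrite addn1 ltnS leqn0 -leqn0 leqNgt -has_count -all_predC.
    apply/allP => x _ /=; apply/negP => /andP[xJ].
    exact/negP/iJ.
  rewrite addn0 -size_filter.
  have : uniq (filter (fun x => (x \in J) && G v x) l) by rewrite filter_uniq.
  case E : (filter _ l) => [|a [|b s]] //= /andP[].
  have : a \in filter (fun x => (x \in J) && G v x) l by rewrite E inE eqxx.
  have : b \in filter (fun x => (x \in J) && G v x) l.
    by rewrite E !inE eqxx orbT.
  rewrite !mem_filter => /andP[/andP[bJ Gb] bl] /andP[/andP[aJ Ga] al].
  rewrite inE negb_or => /andP[ab _] _.
  by have := iJ a b aJ bJ; rewrite cl.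
have {}IH := IH w' sl; rewrite -/I in IH.
rewrite big_cons; set c := count _ l in wJ cJ.
have : (if v \in J then w v else 0) + c * w v <= w v.
  by move: cJ; case: (v \in J); case: c {wJ} => [|[|c]] //; lia.
case: (boolP (has (G v) I)) wI => hI wI /=; rewrite ?andbT ?andbF ?[0 < w v]lt0n.
  by case: (v \in J); lia.
case: (eqVneq (w v) 0) => [w0|_] /=; first by case: (v \in J); rewrite ?w0; lia.
by rewrite big_cons; case: (v \in J); lia.
Qed.

(* The most recently visited vertex comes first. *)
Fixpoint mcs_order (l : seq T) : Prop :=
  if l is v :: l' then
    [/\ v \notin l',
        forall u, u \notin l' -> count (G u) l' <= count (G v) l'
      & mcs_order l']
  else True.

(* x and y are connected in G[U + x + y], expressed by cuts. *)
Definition linked (U : pred T) (x y : T) : Prop :=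
  forall D : {set T}, x \in D -> y \notin D ->
  exists u w, [/\ u \in D, w \notin D, G u w & [/\
    [|| u \in U, u == x | u == y] & [|| w \in U, w == x | w == y]]].

Lemma linkedC U x y : linked U x y -> linked U y x.
Proof.
move=> L D yD xD; have := L (~: D); rewrite !inE yD xD.
case=> // u [w] [uD wD Guw [uU wU]]; exists w, u; split.
- by rewrite inE negbK in wD.
- by rewrite inE in uD.
- by rewrite edgeC.
- by rewrite [(u == y) || _]orbC [(w == y) || _]orbC.
Qed.

(** * Geometry of unit interval representations *)

Section Interval.
Import Order.TTheory GRing.Theory Num.Theory.

Lemma unit_interval_dist (R : realType) :
  unit_interval_graph G R ->
  exists f : T -> R, forall x y, G x y = (x != y) && (`|f x - f y| <= 1)%R.
Proof.
case=> f H; exists f => x y; apply/idP/idP => [/H[-> [t]]|/andP[xy]].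
  rewrite !in_itv /= => -[/andP[a b] /andP[c d]].
  by rewrite ler_norml; apply/andP; split; lra.
rewrite ler_norml => /andP[a b]; apply/H; split=> //.
exists (Num.max (f x) (f y)); rewrite !in_itv /= !le_max !ge_max !lexx !orbT /=.
by split; apply/andP; split; lra.
Qed.

Variables (R : realType) (f : T -> R).
Hypothesis Gf : forall x y, G x y = (x != y) && (`|f x - f y| <= 1)%R.

Lemma edge_dist x y : G x y -> (f x <= f y + 1)%R /\ (f y <= f x + 1)%R.
Proof. by rewrite Gf ler_norml => /andP[_ /andP[]]; split; lra. Qed.

Lemma nonedge_dist x y : x != y -> ~~ G x y ->
  (f y + 1 < f x)%R \/ (f x + 1 < f y)%R.
Proof.
rewrite Gf ler_norml => -> /=; rewrite negb_and -!ltNge => /orP[]; first by right; lra.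
by left; lra.
Qed.

(** Let [D] consist of the vertices at [f x] or on the side away from [y]. An edge leaving [D] has
    length at most one and passes [f x], so its far end is adjacent to [x]; being neither [x] nor
    [y], this end lies in [U]. *)
Lemma linked_next U x y : linked U x y -> x != y -> ~~ G x y ->
  exists2 v, v \in U /\ G x v & ((f x < f v) = (f x < f y))%R.
Proof.
move=> L xy nxy; case: (nonedge_dist xy nxy) => xyf.
- have := L [set a | f x <= f a]%R; rewrite !inE lexx -ltNge.
  case=> // [|u [w]]; first by lra.
  rewrite !inE -ltNge => -[xu wx Guw [uU wU]]; have [uw wu] := edge_dist Guw.
  have Gxw : G x w.
    rewrite Gf ler_norml; apply/andP; split; last by apply/andP; split; lra.
    by apply: contraTneq wx => ->; rewrite ltxx.
  exists w; last by rewrite !ltNge; congr (~~ _); lra.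
  split=> //; case/or3P: wU => // /eqP wE; rewrite wE in Gxw wx.
    by rewrite edge_irr in Gxw.
  by rewrite Gxw in nxy.
- have := L [set a | f a <= f x]%R; rewrite !inE lexx -ltNge.
  case=> // [|u [w]]; first by lra.
  rewrite !inE -ltNge => -[xu wx Guw [uU wU]]; have [uw wu] := edge_dist Guw.
  have Gxw : G x w.
    rewrite Gf ler_norml; apply/andP; split; last by apply/andP; split; lra.
    by apply: contraTneq wx => ->; rewrite ltxx.
  exists w; last by rewrite wx; lra.
  split=> //; case/or3P: wU => // /eqP wE; rewrite wE in Gxw wx.
    by rewrite edge_irr in Gxw.
  by rewrite Gxw in nxy.
Qed.

(** After cancelling the elements satisfying both predicates, [a] still has [x], so [b] must have an
    element left too. *)
Lemma count_lt (a b : pred T) l x : count a l <= count b l -> x \in l ->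
  a x -> ~~ b x -> exists2 d, d \in l & b d && ~~ a d.
Proof.
move=> cab xl ax bx; apply/hasP; apply: contraTT cab => /hasPn H.
rewrite -ltnNge.
have -> : count a l = count (predI a b) l + count (predI a (predC b)) l.
  by elim: (l) => //= z l' ->; case: (a z); case: (b z); lia.
have -> : count b l = count (predI a b) l.
  by apply: eq_in_count => d /H /=; case: (b d); case: (a d).
by rewrite -{1}[count _ _]addn0 ltn_add2l -has_count; apply/hasP; exists x; rewrite //= ax.
Qed.

(* Suppose that the last visited vertex y is linked to an earlier vertex x
   through unvisited vertices.  Some unvisited neighbour v of x lies on the same
   side of x as y.  As y was preferred to v, which unlike y is adjacent to x, it
   has a visited neighbour d not adjacent to v.  Then x and d are nonadjacent and
   linked through y, contradicting the induction hypothesis. *)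
Lemma mcs_unlinked l : mcs_order l ->
  {in l &, forall x y, x != y -> ~~ G x y -> ~ linked [pred u | u \notin l] x y}.
Proof.
elim: l => [|y l IH] //= [yl cl ml] x z; have {}IH := IH ml.
have shrink a b : linked [pred u | u \notin y :: l] a b ->
                  linked [pred u | u \notin l] a b.
  move=> L D aD bD; have [u [w [uD wD Guw [uU wU]]]] := L D aD bD.
  exists u, w; split=> //; move: uU wU; rewrite !inE !negb_or.
  by split; [case: (u \in l) uU | case: (w \in l) wU]; rewrite ?andbF.
have step a : a \in l -> a != y -> ~~ G a y ->
    ~ linked [pred u | u \notin y :: l] a y.
  move=> al ay nay L; have [v [vU Gav] fv] := linked_next L ay nay.
  move: vU; rewrite !inE negb_or => /andP[vy vl].
  have [d dl] : exists2 d, d \in l & G y d && ~~ G v d.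
    apply: (count_lt (cl v vl) al); first by rewrite edgeC.
    by rewrite edgeC.
  move=> /andP[Gyd nvd].
  have dv : d != v by apply: contraNneq vl => <-.
  have ad : a != d by apply: contraNneq nvd => <-; rewrite edgeC.
  (* If [d] were adjacent to both [a] and [y], it would lie, like [v], within distance one of [a] on
     the side of [y], making [d] and [v] adjacent. *)
  have nad : ~~ G a d.
    apply/negP => Gad; have := nonedge_dist dv; rewrite edgeC => /(_ nvd).
    have := edge_dist Gad; have := edge_dist Gyd; have := edge_dist Gav.
    have := nonedge_dist ay nay; move: fv.
    case: (ltP (f a) (f v)); case: (ltP (f a) (f y)) => //; lra.
  (* A cut with [y] inside is crossed by the edge from [y] to [d]; any other cut separates [a] from
     [y], and [L] applies. *)
  apply: (IH a d al dl ad nad) => D aD dD.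
  case: (boolP (y \in D)) => yD.
    by exists y, d; rewrite !inE yl eqxx !orbT.
  have [u [w [uD wD Guw [uU wU]]]] := L D aD yD.
  exists u, w; split=> //; move: uU wU; rewrite !inE !negb_or.
  split; [move: uU | move: wU].
    by case: (eqVneq u y) => [->|]; rewrite ?yl //= orbF => _ /orP[->|->]; rewrite ?orbT.
  by case: (eqVneq w y) => [->|]; rewrite ?yl //= orbF => _ /orP[->|->]; rewrite ?orbT.
rewrite !inE => /predU1P[->|xl] /predU1P[->|zl] xz nxz.
- by rewrite eqxx in xz.
- by move=> /linkedC; apply: step; rewrite // 1?eq_sym // edgeC.
- exact: step.
- by move=> /shrink; apply: IH.
Qed.

(** Two nonadjacent earlier neighbours of [v] would be linked through [v], which was still
    unvisited. *)
Lemma mcs_simplicial l : mcs_order l -> simplicial_order l.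
Proof.
elim: l => //= v l IH [vl cl ml]; split; [by []| |exact: IH].
move=> x y xl yl Gvx Gvy xy; apply: contraT => nxy.
case: (mcs_unlinked ml xl yl xy nxy) => D xD yD.
case: (boolP (v \in D)) => vD.
  by exists v, y; rewrite !inE vl eqxx !orbT.
by exists x, v; rewrite !inE vl eqxx !orbT edgeC.
Qed.

(** The outer two of three pairwise nonadjacent vertices are more than two apart, while all
    neighbours of [y] lie within one of [f y]. *)
Lemma indep_nbrs_le2 I y : indep I -> #|nbrs y :&: I| <= 2.
Proof.
move=> iI; rewrite leqNgt; apply/card_gt2P => -[a [b [c]]] [[]].
rewrite !inE => /andP[Ga aI] /andP[Gb bI] /andP[Gc cI] [ab bc ca].
have := nonedge_dist ab (iI _ _ aI bI).
have := nonedge_dist bc (iI _ _ bI cI).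
have := nonedge_dist ca (iI _ _ cI aI).
have := edge_dist Ga; have := edge_dist Gb; have := edge_dist Gc; lra.
Qed.

Lemma card_singly I : max_indep I ->
  #|singly I| + \sum_(x in I) #|nbrs x| = 2 * (#|T| - #|I|).
Proof.
move=> mI; have iI := mI.1; 
have <- : #|~: I| = #|T| - #|I| by rewrite cardsCs setCK.
under eq_bigr do rewrite -[nbrs _]setIT.
rewrite sum_nbrsC (eq_bigl predT) => [|x]; last by rewrite inE.
rewrite -sum1_card big_mkcond /=.
rewrite -big_split /= mulnC -sum_nat_const [RHS]big_mkcond /=.
(* With [d] the number of neighbours in [I], a vertex outside [I] contributes 1 + 1 if [d] is 1 and
   0 + 2 if [d] is 2. *)
apply: eq_bigr => y _; rewrite !inE; case: (boolP (y \in I)) => yI /=.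
  by rewrite indep_nbrs.
have := max_indep_nbrs mI yI; have := indep_nbrs_le2 y iI.
by case: #|_| => [|[|[|]]].
Qed.

(* Otherwise the symmetric difference of I and J induces a 2-regular graph, but
   its leftmost vertex has at most one neighbour. *)
Lemma singly_unique I J : max_indep I -> max_indep J ->
  [disjoint singly I & J] -> J = I.
Proof.
move=> mI mJ dJ; have [iI MI] := mI; have [iJ MJ] := mJ.
have cIJ : #|J| = #|I| by apply/eqP; rewrite eqn_leq MI // MJ.
have cD : #|J :\: I| = #|I :\: J| by rewrite !cardsD cIJ setIC.
(* As [y] is not in [singly I], it has two neighbours in [I], and independence of [J] keeps them
   outside [J]. *)
have two y : y \in J :\: I -> #|nbrs y :&: (I :\: J)| = 2.
  rewrite inE => /andP[yI yJ].
  have -> : nbrs y :&: (I :\: J) = nbrs y :&: I.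
    apply/setP => x; rewrite !inE; case: (boolP (x \in J)) => //= xJ.
    by rewrite (negbTE (iJ _ _ yJ xJ)).
  have := max_indep_nbrs mI yI; have := indep_nbrs_le2 y iI.
  have : #|nbrs y :&: I| != 1.
    by have /pred0P/(_ y) := dJ; rewrite /= inE yJ andbT => ->.
  by case: #|_| => [|[|[|]]].
(* Both sides have equal size, so the degrees on this side also average two; being at most two, they
   all equal two. *)
have two' x : x \in I :\: J -> #|nbrs x :&: (J :\: I)| = 2.
  have le2 z : #|nbrs z :&: (J :\: I)| <= 2.
    by apply: leq_trans (indep_nbrs_le2 z iJ); apply/subset_leq_card/setIS/subsetDl.
  have : \sum_(z in I :\: J) (2 - #|nbrs z :&: (J :\: I)|) = 0.
    rewrite sumnB // sum_nbrsC (eq_bigr _ two) !sum_nat_const.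
    by rewrite cD subnn.
  by move=> /eqP; rewrite sum_nat_eq0 => /forallP/(_ x)/implyP H /H; have := le2 x; lia.
apply/eqP; apply: contraT => nJI.
have [z0 z0D] : exists z, z \in (J :\: I) :|: (I :\: J).
  apply/set0Pn; apply: contra nJI; rewrite setU_eq0 !setD_eq0 => /andP[JI IJ].
  by rewrite eqEsubset JI.
case: (@arg_minP _ R _ z0 [in (J :\: I) :|: (I :\: J)] f z0D) => z zD zmin.
(* Two neighbours of the leftmost vertex [z] lie in a segment of length one starting at [f z], so
   they are adjacent. *)
have no (A B : {set T}) : indep B -> B :\: A \subset (J :\: I) :|: (I :\: J) ->
    #|nbrs z :&: (B :\: A)| <> 2.
  move=> iB sB c2; have : 1 < #|nbrs z :&: (B :\: A)| by rewrite c2.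
  move=> /card_gt1P[a [b]]; rewrite !in_setI => -[/andP[Ga aB] /andP[Gb bB] ab].
  have za := zmin a (subsetP sB a aB); have zb := zmin b (subsetP sB b bB).
  move: aB bB; rewrite !inE in Ga Gb * => /andP[_ aB] /andP[_ bB].
  have := nonedge_dist ab (iB _ _ aB bB).
  have := edge_dist Ga; have := edge_dist Gb; lra.
move: zD => /=; rewrite in_setU => /orP[/two|/two'] c2.
  by case: (no J I) => //; rewrite subsetUr.
by case: (no I J) => //; rewrite subsetUl.
Qed.

Theorem min_pau_set_singly (I : {set T}) (K : nat) :
  \sum_x #|nbrs x| < K -> indep I ->
  (forall J : {set T}, indep J ->
     \sum_(x in J) (K + #|nbrs x|) <= \sum_(x in I) (K + #|nbrs x|)) ->
  min_pau_set G (singly I).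
Proof.
move=> hK iI opt.
have degK (J : {set T}) : \sum_(x in J) #|nbrs x| < K.
  by apply: leq_ltn_trans hK; rewrite [leqRHS](bigID (mem J)) leq_addr.
have {}opt (J : {set T}) : indep J ->
    #|J| * K + \sum_(x in J) #|nbrs x| <= #|I| * K + \sum_(x in I) #|nbrs x|.
  by move=> /opt; rewrite !big_split /= !sum_nat_const.
have mI : max_indep I.
  split=> // J /opt; have := degK I; case: (leqP #|J| #|I|) => // lIJ.
  have := leq_mul lIJ (leqnn K); rewrite mulSn; lia.
apply/andP; split.
  apply/pau_setP; exists I => [|J mJ dJ]; last exact: singly_unique.
  split=> //; apply/pred0P => y /=; apply/negbTE/negP => /andP[].
  by rewrite inE => /eqP + yI; rewrite indep_nbrs.
(* Any competitor contains [singly J] for a maximum [J]; [card_singly] for [I] and [J] turns the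
   larger degree sum of [I] into a smaller [singly I]. *)
apply/forallP => S'; apply/implyP => /pau_set_singly[J mJ /subset_leq_card].
apply: leq_trans; have := card_singly mI; have := card_singly mJ.
have := opt J mJ.1; have -> : #|J| = #|I|.
  by apply/eqP; rewrite eqn_leq mI.2 ?mJ.2 //; case: mJ.
lia.
Qed.

Lemma min_pau_set_frank (K : nat) (w : T -> nat) (l : seq T) :
  (forall x, w x = K + #|nbrs x|) -> \sum_x #|nbrs x| < K ->
  (forall x, x \in l) -> mcs_order l ->
  min_pau_set G (singly [set x in frank w l]).
Proof.
move=> wE hK lT /mcs_simplicial sl; have ul := simplicial_order_uniq sl.
apply: (min_pau_set_singly hK) => [|J iJ]; first exact: frank_indep.
under eq_bigr do rewrite -wE; under [leqRHS]eq_bigr do rewrite -wE.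
have sumE (s : seq T) (A : {set T}) (F : T -> nat) : uniq s -> A =i s ->
    \sum_(x <- s) F x = \sum_(x in A) F x.
  by move=> us As; rewrite big_uniq //; apply: eq_bigl => x; rewrite As.
have := frank_opt w sl iJ; rewrite -big_filter (sumE _ J) ?filter_uniq // => [le|x].
  apply: leq_trans le _; apply/eq_leq/sumE; first exact: frank_uniq.
  by move=> x; rewrite inE.
by rewrite mem_filter lT andbT.
Qed.

End Interval.

End Graph.

(** * Verification of programs with a time bound *)

(** Evaluation without word bound, which agrees with [eval] on safe expressions once [W] is large
    enough. *)
Fixpoint ev (s : state) (e : expr) : nat :=
  match e with
  | Const k => k
  | Var x => var s x
  | Get a e1 => arr s a (ev s e1)
  | Bin o e1 e2 => binop_val o (ev s e1) (ev s e2)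
  end.

(* Only 0 or 1 may be added, so that values grow by at most one per time unit
   and the word bound follows from the time bound. *)
Fixpoint safe (e : expr) : bool :=
  match e with
  | Const k => k <= 1
  | Var _ => true
  | Get _ e1 => safe e1
  | Bin OAdd e1 e2 => safe e1 && (if e2 is Const k then k <= 1 else false)
  | Bin _ e1 e2 => safe e1 && safe e2
  end.

Definition bounded (B : nat) (s : state) : Prop :=
  (forall x, var s x <= B) /\ (forall a i, arr s a i <= B).

Lemma boundedW B B' s : B <= B' -> bounded B s -> bounded B' s.
Proof. by move=> le [bv ba]; split=> *; apply: leq_trans le. Qed.

Lemma eval_safe W B s e : 0 < B -> bounded B s -> safe e -> B + cost e <= W ->
  eval W s e = Some (ev s e) /\ ev s e <= B + cost e.
Proof.
move=> B0 [bv ba]; have wd v : v <= W -> word W v = Some v by rewrite /word => ->.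
elim: e => [k|x|a e IH|o e1 IH1 e2 IH2] /=.
- by move=> k1 hW; split; [apply: wd; lia | lia].
- by move=> _ hW; have := bv x; split; [apply: wd; lia | lia].
- move=> se hW; case: IH => // [|-> le]; first by lia.
  by have := ba a (ev s e); split; [apply: wd; lia | lia].
- move=> sf hW; have /andP[s1 s2] : safe e1 && safe e2.
    by case: o sf => //= /andP[-> +]; case: (e2).
  case: IH1 => // [|-> l1]; first by lia.
  case: IH2 => // [|-> l2]; first by lia.
  have l : binop_val o (ev s e1) (ev s e2) <= B + (cost e1 + cost e2).+1.
    case: o sf => /=; try lia.
    by move=> /andP[_]; case: (e2) l1 => //= k; lia.
  by split=> //; apply: wd; lia.
Qed.

Fixpoint wvars (c : cmd) : seq nat :=
  match c with
  | Skip | Put _ _ _ => [::]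
  | Assign x _ => [:: x]
  | Seq c1 c2 | If _ c1 c2 => wvars c1 ++ wvars c2
  | While _ c1 => wvars c1
  end.

Fixpoint warrs (c : cmd) : seq nat :=
  match c with
  | Skip | Assign _ _ => [::]
  | Put a _ _ => [:: a]
  | Seq c1 c2 | If _ c1 c2 => warrs c1 ++ warrs c2
  | While _ c1 => warrs c1
  end.

Definition frame (c : cmd) (s s' : state) : Prop :=
  (forall x, x \notin wvars c -> var s' x = var s x) /\
  (forall a, a \notin warrs c -> forall i, arr s' a i = arr s a i).

(** The time and the final state are the same for all sufficiently large [W], so the word bound can
    be fixed after the running time is known. *)
Definition runs (c : cmd) (s : state) (t : nat) (s' : state) : Prop :=
  frame c s s' /\
  forall W B, 0 < B -> bounded B s -> B + t <= W ->
    exec W c s t s' /\ bounded (B + t) s'.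

Definition wp (c : cmd) (Q : nat -> state -> Prop) (s : state) : Prop :=
  exists t s', runs c s t s' /\ Q t s'.

Lemma frame_trans c s1 s2 s3 : frame c s1 s2 -> frame c s2 s3 -> frame c s1 s3.
Proof.
by move=> [v1 a1] [v2 a2]; split=> [x h|a h i]; rewrite ?v2 ?v1 ?a2 ?a1.
Qed.

Lemma frameW c c' s s' : {subset wvars c <= wvars c'} ->
  {subset warrs c <= warrs c'} -> frame c s s' -> frame c' s s'.
Proof.
move=> sv sa [v a]; split=> [x h|b h i]; [apply: v | apply: a].
  by apply: contra h => /sv.
by apply: contra h => /sa.
Qed.

Lemma wp_mono c (Q Q' : nat -> state -> Prop) s :
  (forall t s', Q t s' -> Q' t s') -> wp c Q s -> wp c Q' s.
Proof. by move=> QQ [t [s' [r /QQ q]]]; exists t, s'. Qed.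

(** Lets a postcondition use that variables and arrays not written by [c] are unchanged. *)
Lemma wp_frame c (Q : nat -> state -> Prop) s :
  wp c (fun t s' => frame c s s' -> Q t s') s -> wp c Q s.
Proof. by move=> [t [s' [[f r] q]]]; exists t, s'; split; [by split | apply: q]. Qed.

Lemma wp_skip (Q : nat -> state -> Prop) s : Q 1 s -> wp Skip Q s.
Proof.
move=> q; exists 1, s; split=> //; split=> // W B _ b _; split; first by constructor.
by apply: boundedW b; rewrite leq_addr.
Qed.

Lemma wp_assign x e (Q : nat -> state -> Prop) s : safe e ->
  Q (cost e).+1 (set_var s x (ev s e)) -> wp (Assign x e) Q s.
Proof.
move=> se q; exists (cost e).+1, (set_var s x (ev s e)); split=> //; split.
  by split=> // y; rewrite inE /= => /negbTE ->.
move=> W B B0 b hW; have [|E l] := eval_safe B0 b se (W := W); first by lia.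
split; first by constructor.
have [bv ba] := boundedW (leq_addr (cost e).+1 B) b.
by split=> //= y; case: ifP => // _; lia.
Qed.

Lemma wp_put a ei e (Q : nat -> state -> Prop) s : safe ei -> safe e ->
  Q (cost ei + cost e).+1 (set_arr s a (ev s ei) (ev s e)) -> wp (Put a ei e) Q s.
Proof.
move=> si se q; exists (cost ei + cost e).+1, (set_arr s a (ev s ei) (ev s e)).
split=> //; split.
  by split=> // y; rewrite inE /= => /negbTE -> i.
move=> W B B0 b hW; have [|E l] := eval_safe B0 b se (W := W); first by lia.
have [|Ei _] := eval_safe B0 b si (W := W); first by lia.
split; first by constructor.
have [bv ba] := boundedW (leq_addr (cost ei + cost e).+1 B) b.
by split=> //= y j; case: ifP => // _; lia.
Qed.

Lemma wp_seq c1 c2 (Q : nat -> state -> Prop) s :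
  wp c1 (fun t1 s1 => wp c2 (fun t2 s2 => Q (t1 + t2) s2) s1) s ->
  wp (Seq c1 c2) Q s.
Proof.
move=> [t1 [s1 [[f1 r1] [t2 [s2 [[f2 r2] q]]]]]]; exists (t1 + t2), s2.
split=> //; split.
  apply: (frame_trans (s2 := s1)).
    by apply: frameW f1 => x; rewrite /= mem_cat => ->.
  by apply: frameW f2 => x; rewrite /= mem_cat orbC => ->.
move=> W B B0 b hW; have [|e1 b1] := r1 W B B0 b; first by lia.
have [||e2 b2] := r2 W _ _ b1; [lia | lia |].
by split; [apply: ExecSeq e1 e2 | apply: boundedW b2; lia].
Qed.

Lemma wp_if e c1 c2 (Q : nat -> state -> Prop) s : safe e ->
  wp (if ev s e != 0 then c1 else c2) (fun t s' => Q ((cost e).+1 + t) s') s ->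
  wp (If e c1 c2) Q s.
Proof.
move=> se [t [s' [[f r] q]]]; exists ((cost e).+1 + t), s'; split=> //; split.
  by apply: frameW f => x; rewrite /= mem_cat; case: ifP => _ ->; rewrite ?orbT.
move=> W B B0 b hW; have [|E _] := eval_safe B0 b se (W := W); first by lia.
have [|e' b'] := r W B B0 b; first by lia.
by split; [apply: ExecIf E e' | apply: boundedW b'; lia].
Qed.

(* The index of the invariant is an upper bound of the remaining time. *)
Lemma wp_while e c (I : nat -> state -> Prop) (Q : state -> Prop) p s :
  safe e ->
  (forall p s, I p s -> if ev s e == 0 then (cost e).+1 <= p /\ Q s else
     wp c (fun t s' => exists2 p', (cost e).+1 + t + p' <= p & I p' s') s) ->
  I p s -> wp (While e c) (fun t s' => t <= p /\ Q s') s.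
Proof.
move=> se step; elim/ltn_ind: p s => p IH s Ip; have := step p s Ip.
case: eqP => [e0 [le q]|/eqP e0 [t1 [s1 [[f1 r1] [p' le Ip']]]]].
  exists (cost e).+1, s; split=> //; split=> // W B B0 b hW.
  have [|E _] := eval_safe B0 b se (W := W); first by lia.
  split; last by apply: boundedW b; lia.
  by apply: ExecWhileEnd; rewrite E e0.
have [|t2 [s2 [[f2 r2] [le2 q]]]] := IH p' _ s1 Ip'; first by lia.
exists ((cost e).+1 + t1 + t2), s2; split; last by split=> //; lia.
split; first exact: frame_trans f1 f2.
move=> W B B0 b hW; have [|E _] := eval_safe B0 b se (W := W); first by lia.
have [|e1 b1] := r1 W B B0 b; first by lia.
have [||e2 b2] := r2 W _ _ b1; [lia | lia |].
by split; [apply: ExecWhileStep E e0 e1 e2 | apply: boundedW b2; lia].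
Qed.

Definition incr (x : nat) : cmd := Assign x (Bin OAdd (Var x) (Const 1)).

Definition for_node (x : nat) (body : cmd) : cmd :=
  Seq (Assign x (Const 0))
      (While (Bin OLt (Var x) (Var 0)) (Seq body (incr x))).

Definition for_nbr (v i u : nat) (body : cmd) : cmd :=
  Seq (Assign i (Get 0 (Var v)))
      (While (Bin OLt (Var i) (Get 0 (Bin OAdd (Var v) (Const 1))))
             (Seq (Assign u (Get 1 (Var i))) (Seq body (incr i)))).

(** * The input representation and loops over vertices and neighbours *)

Section Input.
Variables (n : nat) (adj : 'I_n -> seq 'I_n).

(** The part of the initial state that all phases preserve. List positions are given by splittings,
    which match the loop invariants; cell [n] of array 0 yields the degree sum. *)
Definition input (s : state) : Prop :=
  [/\ var s 0 = n, arr s 0 n = \sum_v size (adj v),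
      forall v : 'I_n, arr s 0 v.+1 = arr s 0 v + size (adj v)
    & forall v p u q, adj v = p ++ u :: q -> arr s 1 (arr s 0 v + size p) = u].

Lemma input_init : input (init_state adj).
Proof.
set L := [seq [seq val u | u <- adj v] | v <- enum 'I_n].
have sL : size L = n by rewrite size_map size_enum_ord.
have sS : size (shape L) = n by rewrite size_map.
have nthL (v : 'I_n) : nth [::] L v = [seq val u | u <- adj v].
  by rewrite (nth_map v) ?size_enum_ord // nth_ord_enum.
have off i : i <= n -> arr (init_state adj) 0 i = sumn (take i (shape L)).
  move=> le; transitivity (nth 0 [seq sumn (take j (shape L)) | j <- iota 0 n.+1] i) => //.
  by rewrite (nth_map 0) ?size_iota // nth_iota.
split=> //.
- rewrite off // take_oversize ?sS // sumnE 2!big_map.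
  by rewrite big_enum; apply: eq_bigr => v _; rewrite size_map.
- move=> v; rewrite !off // 1?ltnW // (take_nth 0) ?sS //.
  rewrite sumn_rcons (nth_map [::]) ?sL // nthL size_map //.
- move=> v p u q E; rewrite off 1?ltnW //= -/L.
  rewrite -[L in flatten L](cat_take_drop v) flatten_cat nth_cat size_flatten.
  rewrite /shape map_take -/(shape L) ltnNge leq_addr /= addKn.
  rewrite (drop_nth [::]) ?sL //= nthL E map_cat /= -catA nth_cat size_map ltnn.
  by rewrite subnn.
Qed.

Lemma input_frame c s s' : 0 \notin wvars c -> 0 \notin warrs c ->
  1 \notin warrs c -> frame c s s' -> input s -> input s'.
Proof.
move=> w0 a0 a1 [fv fa] [i1 i2 i3 i4]; split; rewrite ?fv ?fa // => v.
  by rewrite !fa.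
by move=> p u q E; rewrite !fa //; apply: i4 E.
Qed.

(** Besides the body an iteration pays 4 for the test and 4 for the increment; 6 is the
    initialisation plus the last test. *)
Lemma wp_for_node x body (P : nat -> state -> Prop) (f : 'I_n -> nat) s :
  x != 0 -> x \notin wvars body -> 0 \notin wvars body ->
  0 \notin warrs body -> 1 \notin warrs body ->
  (forall i s k, P i s -> P i (set_var s x k)) ->
  (forall (i : 'I_n) s, input s -> var s x = i -> P i s ->
     wp body (fun t s' => t <= f i /\ P i.+1 s') s) ->
  input s -> P 0 s ->
  wp (for_node x body)
     (fun t s' => [/\ t <= \sum_i (f i + 8) + 6, P n s' & input s']) s.
Proof.
move=> x0 xb v0 a0 a1 Pv step is0 P0.
have inx s' k : input s' -> input (set_var s' x k).
  by case=> *; split; rewrite //= eq_sym (negbTE x0).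
apply: wp_seq; apply: wp_assign => //=.
pose I p s' := exists2 i, i <= n & [/\ var s' x = i, P i s', input s' &
   p = \sum_(j < n | i <= j) (f j + 8) + 4].
apply: wp_mono; last first.
  apply: (wp_while (I := I) (Q := fun s' => P n s' /\ input s')
           (p := \sum_i (f i + 8) + 4)) => //.
  - move=> p s' [i le [xi Pi si ->]] /=; have [n0 _ _ _] := si.
    rewrite xi n0; case: ltnP => lt /=.
      apply: wp_seq; apply: wp_frame.
      apply: wp_mono (step (Ordinal lt) s' si xi Pi) => t s1 [tf Pi1] F.
      have i1 := input_frame v0 a0 a1 F si.
      have x1 : var s1 x = i by rewrite F.1.
      apply: wp_assign => //=.
      exists (\sum_(j < n | i.+1 <= j) (f j + 8) + 4).
        rewrite [leqRHS](_ : _ = (f (Ordinal lt) + 8) +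
           \sum_(j < n | i.+1 <= j) (f j + 8) + 4); first by lia.
        congr (_ + _); rewrite (bigD1 (Ordinal lt)) //=; congr (_ + _).
        by apply: eq_bigl => j; rewrite -val_eqE /=; lia.
      by exists i.+1 => //; split; [rewrite /= eqxx x1 addn1 | apply: Pv | apply: inx |].
    have i_n : i = n by lia.
    by rewrite i_n in Pi; split=> //; lia.
  - exists 0 => //; split; [by rewrite /= eqxx | exact: Pv | exact: inx |].
    by congr (_ + _); apply: eq_bigl.
move=> t s' [le [Pn sn]]; split=> //=.
by rewrite addnC [leqRHS](addnA _ 4 2) leq_add2r.
Qed.

(** An iteration pays 7 for the test, 3 for reading the neighbour and 4 for the increment; 10 is the
    initialisation plus the last test. *)
Lemma wp_for_nbr v i u body (P : seq 'I_n -> state -> Prop) K (x : 'I_n) s :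
  uniq [:: 0; v; i; u] -> ~~ has (mem (wvars body)) [:: 0; v; i] ->
  0 \notin warrs body -> 1 \notin warrs body ->
  (forall p s k, P p s -> P p (set_var s i k)) ->
  (forall p s k, P p s -> P p (set_var s u k)) ->
  (forall p y q s, adj x = p ++ y :: q -> input s -> var s v = x ->
     var s u = y -> P p s ->
     wp body (fun t s' => t <= K /\ P (rcons p y) s') s) ->
  input s -> var s v = x -> P [::] s ->
  wp (for_nbr v i u body)
     (fun t s' => [/\ t <= (K + 14) * size (adj x) + 10, P (adj x) s',
                      input s' & var s' v = x]) s.
Proof.
(* The reversed list supplies every disequality in the other orientation. *)
move=> un; have : uniq (rev [:: 0; v; i; u]) by rewrite rev_uniq.
move: un; rewrite /= !inE !negb_or !andbT.
move=> /andP[/and3P[v0 i0 u0] /andP[/andP[vi vu] iu]].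
move=> /andP[/and3P[ui uv u0'] /andP[/andP[iv i0'] v0']].
move=> /and3P[w0 wv wi] a0 a1 Pi Pu step is0 vx P0.
have ini s' k : input s' -> input (set_var s' i k).
  by case=> *; split; rewrite //= (negbTE i0).
have inu s' k : input s' -> input (set_var s' u k).
  by case=> *; split; rewrite //= (negbTE u0).
apply: wp_seq; apply: wp_assign => //=.
pose I c s' := exists p q, adj x = p ++ q /\ [/\ var s' i = arr s' 0 x + size p,
  P p s', input s', var s' v = x & c = (K + 14) * size q + 7].
apply: wp_mono; last first.
  apply: (wp_while (I := I) (Q := fun s' => [/\ P (adj x) s', input s' & var s' v = x])
           (p := (K + 14) * size (adj x) + 7)) => //.
  - move=> c s' [p [q [E [s'i Pp si s'v ->]]]] /=; have [_ _ io ia] := si.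
    rewrite s'v s'i addn1 io ltn_add2l E size_cat -[X in X < _]addn0 ltn_add2l.
    case: q E => [|y q] E /=; first by rewrite cats0; split=> //; lia.
    apply: wp_seq; apply: wp_assign => //=; apply: wp_seq; apply: wp_frame.
    set s1 := set_var _ _ _.
    have s1u : var s1 u = y by rewrite /= eqxx s'i (ia x p y q E).
    have s1v : var s1 v = x by rewrite /= (negbTE vu).
    have s1i : var s1 i = arr s' 0 x + size p by rewrite /= (negbTE iu).
    apply: wp_mono (step p y q s1 E (inu _ _ si) s1v s1u (Pu _ _ _ Pp)).
    move=> t s2 [tK P2] F; have i2 := input_frame w0 a0 a1 F (inu _ _ si).
    apply: wp_assign => //=; exists ((K + 14) * size q + 7); first by lia.
    exists (rcons p y), q; split; first by rewrite cat_rcons.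
    split; [| exact: Pi | exact: ini | | by []].
      by rewrite /= eqxx F.1 // s1i addn1 F.2 // size_rcons addnS.
    by rewrite /= (negbTE vi) F.1.
  - exists [::], (adj x); split=> //; split; [| exact: Pi | exact: ini | | by []].
      by rewrite /= eqxx vx addn0.
    by rewrite /= (negbTE vi).
by move=> t s' [le [? ? ?]]; split=> //; lia.
Qed.

End Input.

(** * The linear time program *)

(* Scalars: 2 = one more than the highest bucket that may be nonempty,
   3 = number of bucket entries created, 4 = number of visited vertices.
   Arrays: 3 = number of visited neighbours, 4 = visited flag, 5 = head of each
   bucket, 6 and 7 = vertex and successor of each bucket entry, 8 = visit order,
   9 = residual weight, 10 = positive residual weight when eliminated,
   11 = number of selected neighbours. *)
Definition prog_init : cmd :=
  Seq (for_node 9 (Seq (Put 6 (Bin OAdd (Var 9) (Const 1)) (Var 9))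
                       (Put 7 (Bin OAdd (Var 9) (Const 1)) (Var 9))))
 (Seq (Put 5 (Const 0) (Var 0))
 (Seq (Assign 3 (Var 0))
      (Assign 2 (Const 1)))).

(** The former entry of the vertex is left in its old bucket, where it becomes obsolete. *)
Definition prog_push : cmd :=
  Seq (Put 3 (Var 8) (Bin OAdd (Get 3 (Var 8)) (Const 1)))
 (Seq (incr 3)
 (Seq (Put 6 (Var 3) (Var 8))
 (Seq (Put 7 (Var 3) (Get 5 (Get 3 (Var 8))))
      (Put 5 (Get 3 (Var 8)) (Var 3))))).

Definition prog_visit : cmd :=
  Seq (Put 4 (Var 6) (Const 1))
 (Seq (Put 8 (Var 4) (Var 6))
 (Seq (incr 4)
 (Seq (for_nbr 6 7 8 (If (Get 4 (Var 8)) Skip prog_push))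
      (incr 2)))).

Definition prog_mcs : cmd :=
  While (Var 2)
    (Seq (Assign 5 (Get 5 (Bin OSub (Var 2) (Const 1))))
         (If (Var 5)
             (Seq (Put 5 (Bin OSub (Var 2) (Const 1)) (Get 7 (Var 5)))
             (Seq (Assign 6 (Get 6 (Var 5)))
                  (If (Get 4 (Var 6)) Skip prog_visit)))
             (Assign 2 (Bin OSub (Var 2) (Const 1))))).

(** The last offset is the sum of all degrees, so the starting value is an admissible [K]. *)
Definition prog_weights : cmd :=
  for_node 6
    (Seq (Put 9 (Var 6) (Bin OAdd (Get 0 (Var 0)) (Const 1)))
         (for_nbr 6 7 8 (Put 9 (Var 6) (Bin OAdd (Get 9 (Var 6)) (Const 1))))).

(** The descending half of the recursion of [frank], reading the visit order backwards. *)
Definition prog_reduce : cmd :=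
  for_node 9
    (Seq (Assign 6 (Get 8 (Bin OSub (Var 0) (Bin OAdd (Var 9) (Const 1)))))
         (If (Get 9 (Var 6))
             (Seq (Put 10 (Var 6) (Const 1))
                  (for_nbr 6 7 8
                     (Put 9 (Var 8) (Bin OSub (Get 9 (Var 8)) (Get 9 (Var 6))))))
             Skip)).

(** The returning half of the recursion, hence in visit order. The counts in array 11 decide
    selection here and membership in [singly] afterwards. *)
Definition prog_select : cmd :=
  for_node 9
    (Seq (Assign 6 (Get 8 (Var 9)))
         (If (Get 10 (Var 6))
             (If (Get 11 (Var 6)) Skip
                 (for_nbr 6 7 8
                    (Put 11 (Var 8) (Bin OAdd (Get 11 (Var 8)) (Const 1)))))
             Skip)).

Definition prog_output : cmd :=
  for_node 9
    (If (Bin OEq (Get 11 (Var 9)) (Const 1))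
        (Seq (Put 2 (Var 1) (Var 9)) (incr 1))
        Skip).

Definition pau_prog : cmd :=
  Seq prog_init (Seq prog_mcs
 (Seq prog_weights (Seq prog_reduce (Seq prog_select prog_output)))).

Ltac wp_run := do ![apply: wp_seq | apply: wp_assign => // | apply: wp_put => //].

(** * Correctness and running time of the phases *)

Section Phases.
Variables (n : nat) (G : sgraph 'I_n) (adj : 'I_n -> seq 'I_n).
Hypothesis adjG : adjacency_lists G adj.

Lemma mem_adj v u : (u \in adj v) = G v u.
Proof. by rewrite (adjG v).2. Qed.

(** A linked list starting at entry [p]: entries are numbered from 1 to [m], and 0 is the null
    pointer. *)
Fixpoint chain (ent nxt : nat -> nat) (m p : nat) (l : seq 'I_n) : Prop :=
  if l is v :: l' then
    [/\ 0 < p <= m, ent p = v & chain ent nxt m (nxt p) l']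
  else p = 0.

Lemma chain_extend ent nxt ent' nxt' m m' p l : m <= m' ->
  (forall q, q <= m -> ent' q = ent q /\ nxt' q = nxt q) ->
  chain ent nxt m p l -> chain ent' nxt' m' p l.
Proof.
move=> le E; elim: l p => //= v l IH p [/andP[p0 pm] ep c].
have [Ee En] := E p pm; split; rewrite ?Ee ?En //; first by rewrite p0 (leq_trans pm).
exact: IH.
Qed.

Definition flagged (vis : seq 'I_n) (s : state) : Prop :=
  forall u : 'I_n, arr s 4 u = (u \in vis).

(* Bucket j is a stack of vertices; an entry of an unvisited vertex u is
   obsolete if j < cf u. *)
Definition buckets (vis : seq 'I_n) (cf : 'I_n -> nat) (c : nat)
    (bk : nat -> seq 'I_n) (s : state) : Prop :=
  [/\ forall u : 'I_n, u \notin vis -> arr s 3 u = cf u /\ u \in bk (cf u),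
      forall j, chain (arr s 6) (arr s 7) (var s 3) (arr s 5 j) (bk j),
      forall j u, u \in bk j -> u \notin vis -> j <= cf u
    & forall j, c <= j -> bk j = [::]].

Lemma buckets_ext vis vis' cf cf' c bk s : {subset vis <= vis'} ->
  (forall u, u \notin vis' -> cf' u = cf u) ->
  buckets vis cf c bk s -> buckets vis' cf' c bk s.
Proof.
move=> sv E [b2 b3 b4 b5].
have nv u : u \notin vis' -> u \notin vis by apply/contra/sv.
split=> // [u uv|j u uj uv]; rewrite E //; first exact/b2/nv.
exact/b4/nv.
Qed.

Lemma wp_push vis cf c bk (u : 'I_n) s :
  u \notin vis -> (cf u).+1 < c -> var s 8 = u -> flagged vis s -> buckets vis cf c bk s ->
  wp prog_push (fun t s' => t <= 22 /\ flagged vis s' /\ exists bk',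
    buckets vis (fun x => if x == u then (cf u).+1 else cf x) c bk' s' /\
    \sum_(j < c) size (bk' j) = (\sum_(j < c) size (bk j)).+1) s.
Proof.
move=> uv uc su b1 [b2 b3 b4 b5]; have [s3 ub] := b2 u uv.
rewrite /prog_push /incr; wp_run => /=; do 2!split=> //.
exists (fun j => if j == (cf u).+1 then u :: bk j else bk j); split; last first.
  rewrite (bigD1 (Ordinal uc)) //= eqxx [in RHS](bigD1 (Ordinal uc)) //= addSn.
  congr (_ + _).+1; apply: eq_bigr => j; rewrite -val_eqE /= => /negbTE ->.
  by [].
rewrite su /= eqxx s3 !addn1.
(* The new entry has a fresh number, so existing lists are not disturbed. *)
have ch p l : chain (arr s 6) (arr s 7) (var s 3) p l ->
  chain (fun j => if j == (var s 3).+1 then val u else arr s 6 j)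
    (fun j => if j == (var s 3).+1 then arr s 5 (cf u).+1 else arr s 7 j)
    (var s 3).+1 p l.
  by apply: chain_extend => // q qs; rewrite ltn_eqF.
split=> //=.
- move=> x xv; rewrite val_eqE; have [-> |xu] := eqVneq x u.
    by rewrite eqxx mem_head.
  have [-> xb] := b2 x xv; split=> //=.
  by case: ifP => // _; rewrite inE xb orbT.
- move=> j; case: eqP => [->|_] /=; last exact: ch.
  by rewrite !eqxx leqnn; split=> //; apply: ch.
- move=> j x; case: eqP => [->|_].
    rewrite inE; have [-> //|xu /=] := eqVneq x u; exact: b4.
  have [-> /b4 H /H|_] := eqVneq x u; last exact: b4.
  by move/leqW.
- by move=> j cj; rewrite b5 //; case: eqP => // jE; rewrite jE in cj; lia.
Qed.

(** As [rl] starts with the latest vertex, the tail behind a vertex consists of those visited before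
    it. *)
Definition visits (rl : seq 'I_n) (s : state) : Prop :=
  forall p u q, rl = p ++ u :: q -> arr s 8 (size q) = u.

Lemma wp_visit (v : 'I_n) rl c bk s :
  input adj s -> var s 6 = v -> var s 2 = c -> var s 4 = size rl ->
  visits rl s -> v \notin rl ->
  (forall u, u \notin v :: rl -> count (G u) rl < c) ->
  flagged rl s -> buckets (v :: rl) (fun u => count (G u) rl) c bk s ->
  wp prog_visit (fun t s' => t <= 39 * size (adj v) + 24 /\ exists bk',
    [/\ input adj s' /\ flagged (v :: rl) s', buckets (v :: rl) (fun u => count (G u) (v :: rl)) c.+1 bk' s',
        var s' 2 = c.+1 /\ var s' 4 = (size rl).+1, visits (v :: rl) s'
      & \sum_(j < c.+1) size (bk' j) <= \sum_(j < c) size (bk j) + size (adj v)]) s.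
Proof.
move=> si s6 s2 s4 s8 vrl clt b1 [b2 b3 b4 b5].
rewrite /prog_visit /incr; apply: wp_seq; apply: wp_put => //.
apply: wp_seq; apply: wp_put => //; apply: wp_seq; apply: wp_assign => //.
apply: wp_seq => /=; rewrite s6 s4 addn1; set s1 := set_var _ _ _.
have s1i : input adj s1 by [].
(* Once the neighbours in [p] are scanned, exactly these have been credited with [v]; for
   [p = adj v] this is the count for [v :: rl]. *)
pose cf (p : seq 'I_n) (u : 'I_n) := count (G u) rl + (u \in p).
pose P (p : seq 'I_n) s' := flagged (v :: rl) s' /\ exists bk', buckets (v :: rl) (cf p) c.+1 bk' s' /\
   \sum_(j < c.+1) size (bk' j) <= \sum_(j < c) size (bk j) + size p.
apply: wp_frame.
apply: wp_mono; last first.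
  apply: (wp_for_nbr (adj := adj) (x := v) (P := P) (K := 25)) => //.
  - move=> p y q s' E s'i s'6 s'8 [b1' [bk' [B sz]]].
    apply: wp_if => //=; rewrite s'8 b1'; case: ifP => /= yv.
      apply: wp_skip; do 2!split=> //; exists bk'; split; last by rewrite size_rcons; lia.
      apply: buckets_ext B => // u uv; rewrite /cf mem_rcons inE.
      by case: eqP => // uy; rewrite uy in uv; rewrite (negbTE uv) in yv.
    have {}yv : y \notin v :: rl by rewrite -eqb0; case: (y \in _) yv.
    have yp : y \notin p.
      have := (adjG v).1; rewrite E cat_uniq => /and3P[_ /hasPn/(_ y) H _].
      by apply: H; rewrite mem_head.
    have cy : (cf p y).+1 < c.+1 by rewrite /cf (negbTE yp) addn0 ltnS clt.
    apply: wp_mono (wp_push yv cy s'8 b1' B) => t s2' [t22 [b2' [bk2 [B2 sz2]]]].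
    split; first by lia.
    split=> //.
    exists bk2; split; last by rewrite sz2 size_rcons; lia.
    apply: buckets_ext B2 => // u _; rewrite /cf mem_rcons inE.
    by case: eqP => [->|//]; rewrite (negbTE yp) addn0 addn1.
  - split=> [u|]; first by rewrite /= b1 inE val_eqE; case: (u == v).
    exists bk; split; last by rewrite big_ord_recr /= b5 // !addn0.
    split=> //= [u|j u uj|j cj].
    + by rewrite /cf addn0 => /b2.
    + by rewrite /cf addn0 => /(b4 _ _ uj).
    + by apply: b5; apply: ltnW.
move=> t s2' [tl [b2' [bk' [B sz]]] i2 v2] [F Fa]; wp_run => /=.
rewrite F //= s2 addn1; split; first by lia.
exists bk'; split=> //; last first.
- move=> [|x p] u q /= [E1 E].
    by rewrite Fa //= -E -E1 eqxx.
  rewrite Fa //= ltn_eqF; first exact: s8 E.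
  by rewrite E size_cat /=; lia.
- by rewrite F //= !addn1.
- move: B; apply: (buckets_ext (s := s2')) => // u uv.
  by rewrite /cf mem_adj edgeC addnC.
Qed.

(** Entry [i.+1] holds vertex [i] and points to entry [i], so entry [n] heads a stack of all
    vertices. *)
Lemma wp_init s : input adj s -> (forall a i, 1 < a -> arr s a i = 0) ->
  wp prog_init (fun t s' => [/\ t <= 18 * n + 20, input adj s', var s' 2 = 1 &
    flagged [::] s' /\ exists bk, buckets [::] (fun=> 0) 1 bk s' /\ size (bk 0) = n]) s.
Proof.
move=> si s0; rewrite /prog_init; apply: wp_seq; apply: wp_frame.
pose P i s' := forall j, j < i -> arr s' 6 j.+1 = j /\ arr s' 7 j.+1 = j.
apply: wp_mono; last first.
  apply: (wp_for_node (adj := adj) (P := P) (f := fun=> 10)) => //.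
  move=> i s' si' xi Pi; wp_run => /=; split=> // j; rewrite xi addn1 ltnS /= !eqSS.
  by rewrite leq_eqVlt; case: eqP => [->|_ /Pi].
move=> t s1 [tl P1 i1] [F Fa]; have [n1 _ _ _] := i1; wp_run => /=; rewrite n1; split=> //.
  by move: tl; rewrite sum_nat_const card_ord; lia.
split=> [u|]; first by rewrite /= Fa // s0.
exists (fun j => if j is 0 then rev (enum 'I_n) else [::]); split; last first.
  by rewrite size_rev size_enum_ord.
split=> //=.
- by move=> u _; rewrite Fa // s0 // mem_rev mem_enum.
- case=> [|j]; last by rewrite /= Fa // s0.
  suff ch m : m <= n -> chain (arr s1 6) (arr s1 7) n m (rev (take m (enum 'I_n))).
    by have := ch n (leqnn n); rewrite take_oversize // size_enum_ord.
  elim: m => [|m IH] lt; first by rewrite take0.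
  rewrite (take_nth (Ordinal lt)) ?size_enum_ord // rev_rcons /=.
  by have [-> ->] := P1 m lt; rewrite lt nth_enum_ord //; split=> //; apply/IH/ltnW.
- by case.
- by case.
Qed.

Lemma wp_mcs s : input adj s -> var s 2 = 1 -> var s 4 = 0 -> flagged [::] s ->
  (exists bk, buckets [::] (fun=> 0) 1 bk s /\ size (bk 0) = n) ->
  wp prog_mcs (fun t s' => t <= \sum_(u : 'I_n) (80 * size (adj u) + 100) + 40 * n + 30 /\
    (input adj s' /\ exists rl, [/\ mcs_order G rl, forall u, u \in rl & visits rl s'])) s.
Proof.
move=> si s2 s4 fl [bk [B szb]].
pose F u := 80 * size (adj u) + 100.
(* Amortisation: an entry prepays 40 for being popped, a bucket level 20 for a descent, and an
   unvisited vertex its visit together with the entries and the level this creates; 2 is the last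
   test. *)
pose I pot s' := exists rl bk c,
  [/\ input adj s', mcs_order G rl, visits rl s', var s' 4 = size rl & var s' 2 = c] /\
  flagged rl s' /\ buckets rl (fun u => count (G u) rl) c bk s' /\
  pot = 40 * (\sum_(j < c) size (bk j)) + 20 * c + \sum_(u < n | u \notin rl) F u + 2.
apply: wp_mono; last first.
  apply: (wp_while (I := I)
    (p := 40 * (\sum_(j < 1) size (bk j)) + 20 * 1 + \sum_(u < n | u \notin [::]) F u + 2)
    (Q := fun s' => input adj s' /\
       exists rl, [/\ mcs_order G rl, forall u, u \in rl & visits rl s'])) => //.
  - move=> pot s' [rl [bk1 [c [[s'i mo vs s'4 s'2] [b1 [B1 ->]]]]]] /=.
    have [b2 b3 b4 b5] := B1; rewrite s'2.
    case: c => [|c] /= in s'2 b5 B1 *.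
      split; first by lia.
      split=> //; exists rl; split=> // u; apply/negPn/negP => /b2[_].
      by rewrite b5.
    apply: wp_seq; apply: wp_assign => //=.
    rewrite s'2 subn1 /=; set s1 := set_var _ _ _.
    rewrite [\sum_(_ < c.+1) _]big_ord_recr /=; set S := \sum_(_ < c) _.
    have chc := b3 c.
    apply: wp_if => //=; case E: (bk1 c) chc => [|v q] /= chc; rewrite ?chc /=.
      apply: wp_assign => //=; exists (40 * S + 20 * c +
        \sum_(u < n | u \notin rl) F u + 2); first by rewrite /= addn0; lia.
      exists rl, bk1, c; split.
        by split=> //=; rewrite s'2 subn1.
      do 3!split=> //; move=> j; rewrite leq_eqVlt => /predU1P[<- //|]; exact: b5.
    case: chc => /andP[p0 _] pv chc; rewrite -lt0n p0.
    set p := arr s' 5 c in p0 pv chc *.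
    apply: wp_seq; apply: wp_put => //=; rewrite s'2 subn1 /=.
    apply: wp_seq; apply: wp_assign => //=; rewrite /= -/p pv.
    set s2' := set_var _ _ _.
    (* Popping [v] can only remove an entry needed for [v], so the invariant survives with [v]
       counted as visited. *)
    pose bk2 j := if j == c then q else bk1 j.
    have B2 : buckets (v :: rl) (fun u => count (G u) rl) c.+1 bk2 s2'.
      split=> //=.
      + move=> u; rewrite inE negb_or => /andP[uv url]; have [e ub] := b2 u url.
        split=> //; rewrite /bk2; case: eqP => // cE.
        by move: ub; rewrite cE E inE (negbTE uv).
      + by move=> j; rewrite /bk2; case: eqP => // _; exact: b3.
      + move=> j u uj; rewrite inE negb_or => /andP[_]; apply: b4; move: uj; rewrite /bk2.
        by case: eqP => [->|//] uq; rewrite E inE uq orbT.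
      + by move=> j cj; rewrite /bk2 gtn_eqF // b5.
    have bk2c : bk2 c = q by rewrite /bk2 eqxx.
    have sz2 : \sum_(j < c) size (bk2 j) = S.
      by apply: eq_bigr => j _; rewrite /bk2 ltn_eqF.
    have i2 : input adj s2' by case: s'i.
    apply: wp_if => //=; rewrite b1; case: ifP => vrl.
      apply: wp_skip; exists (40 * (\sum_(j < c.+1) size (bk2 j)) + 20 * c.+1 +
        \sum_(u < n | u \notin rl) F u + 2).
        by rewrite /= big_ord_recr /= bk2c sz2; lia.
      exists rl, bk2, c.+1; do 3!split=> //; apply: buckets_ext B2 => // u.
      by rewrite inE => /predU1P[->|//]; move: vrl; case: (v \in rl).
    have {}vrl : v \notin rl by case: (v \in rl) vrl.
    (* An entry never lies above the current count of its unvisited vertex, and no bucket above [c]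
       is occupied, so [v] has the maximum count. *)
    have cv : count (G v) rl = c.
      apply/eqP; rewrite eqn_leq b4 ?E ?mem_head // andbT -ltnS ltnNge.
      by apply/negP => /b5 b0; have [_] := b2 v vrl; rewrite b0.
    have cle u : u \notin rl -> count (G u) rl <= c.
      move=> /b2[_ ub]; rewrite -ltnS ltnNge.
      by apply/negP => /b5 b0; rewrite b0 in ub.
    have RE : \sum_(u < n | u \notin rl) F u = F v + \sum_(u < n | u \notin v :: rl) F u.
      rewrite (bigD1 v) //=; congr (_ + _); apply: eq_bigl => u.
      by rewrite inE negb_or andbC.
    rewrite RE /F; have := wp_visit i2 _ _ _ _ vrl _ _ B2; rewrite /= => /(_ _ _ _ _ _ _) W.
    apply: wp_mono (W _ _ _ _ _ _) => //.
      move=> t s3 [tl [bk3 [[i3 b1'] B3 [s32 s34] vs3 sz3]]].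
      exists (40 * (\sum_(j < c.+2) size (bk3 j)) + 20 * c.+2 +
        \sum_(u < n | u \notin v :: rl) F u + 2).
        move: sz3; rewrite [\sum_(j < c.+1) _]big_ord_recr /= bk2c sz2.
        rewrite /F; lia.
      exists (v :: rl), bk3, c.+2; split; last by split.
      by split=> //=; split=> // u /cle; rewrite cv.
    by move=> u; rewrite inE negb_or => /andP[_ /cle].
  - exists [::], bk, 1; split; first by split=> // -[].
    by split=> //; split=> //; apply: buckets_ext B.
move=> t s' [tl Q]; split=> //; apply: leq_trans tl _.
rewrite big_ord1 szb /F (eq_bigl predT) //; lia.
Qed.

Definition weight (u : 'I_n) : nat := (\sum_v size (adj v)).+1 + size (adj u).

Lemma notin_adj v : v \notin adj v.
Proof. by rewrite mem_adj edge_irr. Qed.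

Lemma adj_cat v p u q : adj v = p ++ u :: q -> u \notin p /\ u != v.
Proof.
move=> E; split; last first.
  by apply: contraNneq (notin_adj v) => uv; rewrite -{1}uv E mem_cat mem_head orbT.
have := (adjG v).1; rewrite E cat_uniq => /and3P[_ /hasPn/(_ u) H _].
by apply: H; rewrite mem_head.
Qed.

Lemma wp_weights s : input adj s ->
  wp prog_weights (fun t s' => [/\ t <= \sum_u (20 * size (adj u) + 24) + 6,
    forall u : 'I_n, arr s' 9 u = weight u & input adj s']) s.
Proof.
move=> si; pose P i s' := forall u : 'I_n, u < i -> arr s' 9 u = weight u.
apply: wp_mono; last first.
  apply: (wp_for_node (adj := adj) (P := P) (f := fun u => 20 * size (adj u) + 16)) => //.
  move=> v s' s'i s'6 Pv; apply: wp_seq; apply: wp_put => //=.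
  set s1 := set_arr _ _ _ _; have [n0 offn _ _] := s'i.
  pose I (p : seq 'I_n) s' := arr s' 9 v = (\sum_v size (adj v)).+1 + size p /\ P v s'.
  apply: wp_mono; last first.
    apply: (wp_for_nbr (adj := adj) (x := v) (P := I) (K := 6)) => //.
      move=> p y q s2 E s2i s26 s28 [s2v Pv2]; wp_run => /=; split=> //.
      split=> [|u uv]; first by rewrite /= s26 eqxx s2v size_rcons addn1 addnS.
      by rewrite /= s26 ltn_eqF //; apply: Pv2.
    split=> [|u uv]; first by rewrite /= s'6 eqxx n0 offn addn0 addn1.
    by rewrite /= s'6 ltn_eqF //; apply: Pv.
  move=> t s2 [tl [s2v Pv2] _ _]; split; first by lia.
  by move=> u; rewrite ltnS leq_eqVlt => /predU1P[/val_inj->|/Pv2].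
move=> t s' [tl H i']; split=> //; last by move=> u; apply: H.
by under eq_bigr do rewrite -[24](addnA 16 8) addnA.
Qed.

Section Frank.
Variable rl : seq 'I_n.
Hypotheses (rlT : forall u, u \in rl) (rlU : uniq rl).

Lemma size_rl : size rl = n.
Proof. by rewrite -(card_uniqP rlU) -[RHS]card_ord; apply: eq_card => u; rewrite rlT. Qed.

Lemma sum_rl (F : 'I_n -> nat) : \sum_i F (nth i rl i) = \sum_v F v.
Proof.
rewrite [RHS](reindex_inj (h := fun i : 'I_n => nth i rl i)) // => i j.
rewrite (set_nth_default j) ?size_rl // => /eqP.
by rewrite nth_uniq ?size_rl // => /eqP/val_inj.
Qed.

Lemma visits_nth s m x : visits rl s -> m < n -> arr s 8 (n - m.+1) = nth x rl m.
Proof.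
move=> vs lt; rewrite -(vs (take m rl) (nth x rl m) (drop m.+1 rl)).
  by rewrite size_drop size_rl.
by rewrite -drop_nth ?size_rl // cat_take_drop.
Qed.

(** The weights seen by [frank] after [j] recursive calls on [rl]. *)
Definition residual (j : nat) : 'I_n -> nat := foldl (reduce G) weight (take j rl).

Lemma residualS j x : j < n ->
  residual j.+1 = reduce G (residual j) (nth x rl j).
Proof. by move=> lt; rewrite /residual (take_nth x) ?size_rl // foldl_rcons. Qed.

(** The sign is recorded at elimination because later steps may still lower the weight of an
    eliminated vertex. *)
Definition positive (j : nat) (s : state) : Prop :=
  forall u : 'I_n, arr s 10 u = (index u rl < j) && (0 < residual (index u rl) u).

Lemma wp_reduce s : input adj s -> visits rl s ->
  (forall u : 'I_n, arr s 9 u = weight u) -> (forall i, arr s 10 i = 0) ->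
  wp prog_reduce (fun t s' => [/\ t <= \sum_u (21 * size (adj u) + 32) + 6,
    positive n s', visits rl s' & input adj s']) s.
Proof.
move=> si vs s9 s10.
pose P i s' := [/\ visits rl s', positive i s' &
  forall u : 'I_n, arr s' 9 u = residual i u].
apply: wp_mono; last first.
  apply: (wp_for_node (adj := adj) (P := P)
            (f := fun i => 21 * size (adj (nth i rl i)) + 24)) => //; last first.
    by split=> // u; rewrite s9 /residual take0.
  move=> i s' s'i s'9 [vs' ps' ws']; apply: wp_seq; apply: wp_assign => //=.
  have [n0 _ _ _] := s'i; set v := nth i rl i.
  have -> : arr s' 8 (var s' 0 - (var s' 9 + 1)) = v.
    by rewrite s'9 n0 addn1 (visits_nth i vs').
  have iv : index v rl = i by rewrite index_uniq ?size_rl.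
  set s1 := set_var _ _ _; have s1i : input adj s1 by [].
  have idx u : (index u rl < i.+1) = (u == v) || (index u rl < i).
    rewrite ltnS leq_eqVlt; congr (_ || _); apply/eqP/eqP => [E|->//].
    by rewrite /v -E nth_index.
  have rS u : residual i.+1 u =
      if G v u then residual i u - residual i v else residual i u.
    by rewrite (residualS i).
  (* Subtracting a zero weight changes nothing, so the neighbours may be skipped. *)
  apply: wp_if => //=; rewrite ws'; case: eqP => [w0|/eqP w0] /=.
    apply: wp_skip; split; first by lia.
    split=> // u.
      by rewrite /= ps' idx; have [->|//] := eqVneq u v; rewrite iv w0 ltnn andbF.
    by rewrite rS /= ws' w0 subn0; case: ifP.
  apply: wp_seq; apply: wp_put => //=.
  set s2 := set_arr _ _ _ _; have s2i : input adj s2 by [].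
  pose I (p : seq 'I_n) s' := [/\ visits rl s', positive i.+1 s' &
    forall u : 'I_n, arr s' 9 u =
      if u \in p then residual i u - residual i v else residual i u].
  apply: wp_mono; last first.
    apply: (wp_for_nbr (adj := adj) (x := v) (P := I) (K := 7)) => //; last first.
      split=> // u; rewrite /= idx val_eqE; have [->|_] := eqVneq u v; last exact: ps'.
      by rewrite iv lt0n w0.
    move=> p y q s3 E s3i s36 s38 [vs3 ps3 ws3]; wp_run => /=; split=> //.
    have [yp yv] := adj_cat E; split=> // u; rewrite /= s36 s38 val_eqE mem_rcons inE.
    (* The subtracted amount stays constant during the scan since [v] is not its own neighbour. *)
    have vp : v \in p = false.
      apply/negbTE; apply: contra (notin_adj v) => vp.
      by rewrite E mem_cat vp.
    by case: eqP => [->|_] /=; rewrite ws3 // ws3 vp (negbTE yp).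
  move=> t s3 [tl [vs3 ps3 ws3] _ _]; split; first by lia.
  by split=> // u; rewrite ws3 mem_adj rS.
move=> t s' [tl [vs' ps' _] s'i]; split=> //; apply: leq_trans tl _.
rewrite -(sum_rl (fun u => 21 * size (adj u) + 32)) leq_add2r; apply: leq_sum => i _.
by rewrite /= -addnA.
Qed.

Definition selected : seq 'I_n := frank G weight rl.

Lemma wp_select s : input adj s -> visits rl s -> positive n s ->
  (forall i, arr s 11 i = 0) ->
  wp prog_select (fun t s' => [/\ t <= \sum_u (20 * size (adj u) + 40) + 6,
    forall u : 'I_n, arr s' 11 u = count (G u) selected & input adj s']) s.
Proof.
move=> si vs ps s11.
(* The result of the recursive call on the last [i] vertices of [rl], that is, the first [i]
   visited. *)
pose I i := frank G (residual (n - i)) (drop (n - i) rl).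
pose P i s' := [/\ visits rl s', positive n s' &
  forall u : 'I_n, arr s' 11 u = count (G u) (I i)].
apply: wp_mono; last first.
  apply: (wp_for_node (adj := adj) (P := P)
    (f := fun i => 20 * size (adj (nth i rl (rev_ord i))) + 32)) => //; last first.
    by split=> // u; rewrite s11 /I subn0 drop_oversize ?size_rl.
  move=> i s' s'i s'9 [vs' ps' ws']; apply: wp_seq; apply: wp_assign => //=.
  have i_n := ltn_ord i; set m := n - i.+1; have mn : m < n by rewrite /m; lia.
  set v := nth i rl m.
  have -> : arr s' 8 (var s' 9) = v.
    by rewrite s'9 -(visits_nth i vs' mn); congr (arr s' 8 _); rewrite /m; lia.
  set s1 := set_var _ _ _; have s1i : input adj s1 by [].
  have iv : index v rl = m by rewrite index_uniq ?size_rl.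
  have IS : I i.+1 = if (0 < residual m v) && ~~ has (G v) (I i) then v :: I i else I i.
    rewrite /I -/m (drop_nth i) ?size_rl // -/v /= -(residualS i mn).
    by have -> : n - i = m.+1 by rewrite /m; lia.
  apply: wp_if => //=; rewrite ps' iv mn /=.
  case: (ltnP 0 (residual m v)) IS => _ /= IS; last first.
    by apply: wp_skip; split; [lia|]; split=> // u; rewrite /= ws' IS.
  apply: wp_if => //=; rewrite ws' -lt0n -has_count; case: (boolP (has _ _)) IS => _ /= IS.
    by apply: wp_skip; split; [lia|]; split=> // u; rewrite /= ws' IS.
  pose J (p : seq 'I_n) s' := [/\ visits rl s', positive n s' &
    forall u : 'I_n, arr s' 11 u = (u \in p) + count (G u) (I i)].
  apply: wp_mono; last first.
    apply: (wp_for_nbr (adj := adj) (x := v) (P := J) (K := 6)) => //.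
    move=> p y q s3 E s3i s36 s38 [vs3 ps3 ws3]; wp_run => /=; split=> //.
    have [yp yv] := adj_cat E; split=> // u; rewrite /= s38 val_eqE mem_rcons inE.
    by case: eqP => [->|_] /=; rewrite ws3 // (negbTE yp) add0n addn1.
  move=> t s3 [tl [vs3 ps3 ws3] _ _]; split; first by lia.
  by split=> // u; rewrite ws3 mem_adj IS edgeC.
move=> t s' [tl [vs' ps' ws'] s'i]; split=> //.
  apply: leq_trans tl _; rewrite leq_add2r.
  rewrite (reindex_inj rev_ord_inj) /= -(sum_rl (fun u => 20 * size (adj u) + 40)).
  apply: leq_sum => i _; have i_n := ltn_ord i.
  rewrite (set_nth_default i) ?size_rl ?subnSK ?subKn -?addnA //; lia.
by move=> u; rewrite ws' /I subnn drop0 /residual take0.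
Qed.

End Frank.

Lemma wp_output s : input adj s -> var s 1 = 0 ->
  wp prog_output (fun t s' => t <= 20 * n + 6 /\
    mkseq (arr s' 2) (var s' 1) = [seq i <- iota 0 n | arr s 11 i == 1]) s.
Proof.
move=> si s1.
pose P i s' := (forall j, arr s' 11 j = arr s 11 j) /\
  mkseq (arr s' 2) (var s' 1) = [seq j <- iota 0 i | arr s 11 j == 1].
apply: wp_mono; last first.
  apply: (wp_for_node (adj := adj) (P := P) (f := fun=> 12)) => //; last first.
    by split=> //; rewrite s1.
  move=> i s' s'i s'9 [a11 E].
  have IE : [seq j <- iota 0 i.+1 | arr s 11 j == 1] =
      [seq j <- iota 0 i | arr s 11 j == 1] ++ (if arr s 11 i == 1 then [:: val i] else [::]).
    by rewrite -[i.+1]addn1 iotaD filter_cat add0n.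
  apply: wp_if => //=; rewrite s'9 a11; case: (arr s 11 i == 1) IE => IE; last first.
    by apply: wp_skip; split=> //; split=> //; rewrite IE cats0.
  rewrite /incr; wp_run; split=> //; split=> //; rewrite IE /=.
  rewrite /mkseq iotaD map_cat /= add0n eqxx s'9; congr (_ ++ _).
  rewrite -E /mkseq; apply/eq_in_map => j; rewrite mem_iota add0n => /andP[_ jl].
  by rewrite ltn_eqF.
move=> t s' [tl [_ E] _]; split=> //.
by move: tl; rewrite sum_nat_const card_ord; lia.
Qed.

Lemma size_adj v : size (adj v) = #|nbrs G v|.
Proof.
have [ua ea] := adjG v; rewrite -(card_uniqP ua); apply: eq_card => u.
by rewrite ea inE.
Qed.

Lemma bounded_init B : n <= B -> \sum_v size (adj v) <= B ->
  bounded B (init_state adj).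
Proof.
move=> nB sB; split=> [x|a i]; first by rewrite /=; case: ifP.
set L := [seq [seq val u | u <- adj v] | v <- enum 'I_n].
have sL : sumn (shape L) <= B.
  rewrite sumnE 2!big_map big_enum; apply: leq_trans sB.
  by apply: eq_leq; apply: eq_bigr => v _; rewrite size_map.
have sT j : sumn (take j (shape L)) <= B.
  by apply: leq_trans sL; rewrite -[in leqRHS](cat_take_drop j (shape L)) sumn_cat leq_addr.
rewrite (_ : arr _ a i =
  if a == 0 then nth 0 [seq sumn (take j (shape L)) | j <- iota 0 n.+1] i
  else if a == 1 then nth 0 (flatten L) i else 0) //; case: ifP => _.
  have [lt|le] := ltnP i n.+1; last by rewrite nth_default //= size_map size_iota.
  by rewrite (nth_map 0) ?size_iota // sT.
case: ifP => // _.
have [lt|le] := ltnP i (size (flatten L)); last by rewrite nth_default.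
have /flattenP[l /mapP[v _ ->] /mapP[u _ ->]] := mem_nth 0 lt.
exact: leq_trans (ltnW (ltn_ord u)) nB.
Qed.

(** The three constants are the sums of those of the six phases. *)
Lemma wp_prog : wp pau_prog (fun t s =>
  t <= 274 * n + 141 * \sum_v size (adj v) + 74 /\
  exists rl, [/\ forall u, u \in rl, mcs_order G rl &
    outputs s (singly G [set x in selected rl])]) (init_state adj).
Proof.
have zero a i : 1 < a -> arr (init_state adj) a i = 0 by case: a => [|[]].
have sumD a b : \sum_u (a * size (adj u) + b) = a * \sum_u size (adj u) + n * b.
  by rewrite big_split /= -big_distrr sum_nat_const card_ord.
apply: wp_seq; apply: wp_frame.
apply: wp_mono (wp_init (input_init adj) zero) => t1 s1 [l1 i1 s12 [fl bk]] [F1 A1].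
apply: wp_seq; apply: wp_frame.
apply: wp_mono (wp_mcs i1 s12 _ fl bk); last by rewrite F1.
move=> t2 s2 [l2 [i2 [rl [mo rlT v2]]]] [F2 A2].
have ul : uniq rl by elim: (rl) mo => //= a l IH [-> _ /IH].
apply: wp_seq; apply: wp_frame.
apply: wp_mono (wp_weights i2) => t3 s3 [l3 w3 i3] [F3 A3].
have v3 : visits rl s3 by move=> p u q E; rewrite A3 //; apply: v2 E.
apply: wp_seq; apply: wp_frame.
apply: wp_mono (wp_reduce rlT ul i3 v3 w3 _); last first.
  by move=> i; rewrite A3 // A2 // A1 // zero.
move=> t4 s4 [l4 p4 v4 i4] [F4 A4].
apply: wp_seq; apply: wp_frame.
apply: wp_mono (wp_select rlT ul i4 v4 p4 _); last first.
  by move=> i; rewrite A4 // A3 // A2 // A1 // zero.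
move=> t5 s5 [l5 c5 i5] [F5 A5].
apply: wp_mono (wp_output i5 _); last by rewrite F5 // F4 // F3 // F2 // F1.
move=> t6 s6 [l6 E6]; split.
  move: l2 l3 l4 l5; rewrite !sumD.
  lia.
exists rl; split=> //; rewrite /outputs E6; apply: uniq_perm.
- by rewrite filter_uniq // iota_uniq.
- by rewrite map_inj_uniq ?enum_uniq //; apply: val_inj.
have us : uniq (selected rl) by apply: frank_uniq.
have c5' (v : 'I_n) : arr s5 11 v = #|nbrs G v :&: [set x in selected rl]|.
  rewrite c5 -size_filter -(card_uniqP (filter_uniq _ us)); apply: eq_card => x.
  by rewrite !inE mem_filter.
move=> i; rewrite mem_filter mem_iota add0n /=; apply/andP/mapP.
  move=> [c1 lt]; exists (Ordinal lt) => //.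
  by rewrite mem_enum inE -c5'.
by move=> [v]; rewrite mem_enum inE -c5' => c1 ->.
Qed.

End Phases.

Theorem theorem7 :
  exists (prog : cmd) (c : nat),
  forall (R : realType) (n : nat) (G : sgraph 'I_n) (adj : 'I_n -> seq 'I_n),
    unit_interval_graph G R -> adjacency_lists G adj ->
    exists (t : nat) (s : state) (S : {set 'I_n}),
      [/\ exec (c * (n + #|edges G| + 1)) prog (init_state adj) t s,
          t <= c * (n + #|edges G| + 1),
          outputs s S
        & min_pau_set G S].
Proof.
exists pau_prog, 300 => R n G adj /unit_interval_dist[f Gf] adjG.
have [t [s [[_ ex] [tle [rl [rlT mo out]]]]]] := wp_prog adjG.
have sE : \sum_v size (adj v) = \sum_v #|nbrs G v|.
  by apply: eq_bigr => v _; apply: size_adj adjG v.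
have sm : \sum_v size (adj v) <= 2 * #|edges G| by rewrite sE sum_deg_edges.
(* [B] bounds all input values; with degree sum at most twice the number of edges, both the time [t]
   and [B + t] stay below the bound with factor 300. *)
pose B := n + 2 * #|edges G| + 1.
have bB : bounded B (init_state adj) by apply: bounded_init; rewrite /B; lia.
exists t, s, (singly G [set x in selected G adj rl]); split=> //.
- have [||//] := ex (300 * (n + #|edges G| + 1)) B _ bB; rewrite /B; lia.
- by lia.
- apply: (min_pau_set_frank Gf (K := (\sum_v size (adj v)).+1)) => //.
    by move=> x; rewrite /weight (size_adj adjG).
  by rewrite sE.
Qed.
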